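(* Let $N_{K_3}$ be the simply connected 2-step nilpotent Lie group associated to the complete graph $K_3$, equipped with the left-invariant metric for which the basis $V_1,V_2,V_3,Z_1,Z_2,Z_3$ of its Lie algebra is orthonormal. Then the geodesic flow on $TN_{K_3}$ is completely integrable.
   Context: The Lie algebra $\mathfrak n_{K_3}$ of $N_{K_3}$ is the real Lie algebra with basis $V_1,V_2,V_3,Z_1,Z_2,Z_3$ and nonzero brackets $[V_1,V_2]=Z_1$, $[V_2,V_3]=Z_2$, $[V_3,V_1]=Z_3$ (and those obtained by skew-symmetry). For a Riemannian manifold $M$ of dimension $n$, $TM$ carries the symplectic form obtained from the canonical one on $T^*M$ via the metric, with Poisson bracket $\{\,,\}$. A smooth $f:TM\to\mathbb R$ is a first integral of the geodesic flow if $\{f,E\}=0$, where $E(v)=\tfrac12\langle v,v\rangle$. The geodesic flow is completely integrable (in the sense of Liouville) if there are $n$ first integrals $f_1,\dots,f_n:TM\to\mathbb R$ with $\{f_i,f_j\}=0$ for all $i,j$ and with gradients linearly independent on an open dense subset of $TM$. *)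

(* Defs.v *)
From HB Require Import structures.
From mathcomp Require Import all_boot all_order all_algebra.
From mathcomp Require Import ring.
From mathcomp Require Import all_classical all_reals all_analysis.

Set Implicit Arguments.
Unset Strict Implicit.
Unset Printing Implicit Defensive.

Import Order.TTheory GRing.Theory Num.Theory.
Import numFieldNormedType.Exports.

Local Open Scope classical_set_scope.
Local Open Scope ring_scope.

(** * Calculus on R^m *)

Fixpoint C_ (R : realType) (m k : nat) (f : 'rV[R]_m -> R) : Prop :=
  if k is k'.+1 then
    (forall p, differentiable f p) /\ (forall u, C_ k' (fun p => 'D_u f p))
  else continuous f.

Definition smooth (R : realType) (m : nat) (f : 'rV[R]_m -> R) : Prop :=
  forall k, C_ k f.

Definition gradient (R : realType) (m : nat) (f : 'rV[R]_m -> R)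
    (p : 'rV[R]_m) : 'rV[R]_m :=
  \row_i 'D_(delta_mx 0 i) f p.

(** * Geodesic flows on a manifold M with a global chart R^n

   A metric is a function [g] with [g x u w] the inner product at [x] of the
   tangent vectors [u] and [w].  A point of TM, as well as a point of T*M or a
   tangent vector to one of these, is an element of ['rV_(n + n)]: the position
   comes first, the (co)vector second. *)

Definition metric (R : realType) (n : nat) : Type :=
  'rV[R]_n -> 'rV[R]_n -> 'rV[R]_n -> R.

(* TM -> T*M, (x, v) |-> (x, <v, .>_x) *)
Definition flat (R : realType) (n : nat) (g : metric R n) (p : 'rV[R]_(n + n)) :
    'rV[R]_(n + n) :=
  row_mx (lsubmx p) (\row_i g (lsubmx p) (rsubmx p) (delta_mx 0 i)).

(* sum_i dx_i /\ dp_i, which is constant in the coordinates (x, p) of T*M *)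
Definition canonical_form (R : realType) (n : nat) (a b : 'rV[R]_(n + n)) : R :=
  (lsubmx a *m (rsubmx b)^T - rsubmx a *m (lsubmx b)^T) 0 0.

(* the pullback of the canonical form by [flat g] *)
Definition symplectic_form (R : realType) (n : nat) (g : metric R n)
    (p a b : 'rV[R]_(n + n)) : R :=
  canonical_form ('D_a (flat g) p) ('D_b (flat g) p).

Definition symplectic_mx (R : realType) (n : nat) (g : metric R n)
    (p : 'rV[R]_(n + n)) : 'M[R]_(n + n) :=
  \matrix_(i, j) symplectic_form g p (delta_mx 0 i) (delta_mx 0 j).

(* the vector X with symplectic_form g p X b = df(b) for all b, that is, with
   X *m symplectic_mx g p = gradient f p *)
Definition hamiltonian_field (R : realType) (n : nat) (g : metric R n)
    (f : 'rV[R]_(n + n) -> R) (p : 'rV[R]_(n + n)) : 'rV[R]_(n + n) :=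
  gradient f p *m invmx (symplectic_mx g p).

Definition poisson (R : realType) (n : nat) (g : metric R n)
    (f h : 'rV[R]_(n + n) -> R) (p : 'rV[R]_(n + n)) : R :=
  symplectic_form g p (hamiltonian_field g f p) (hamiltonian_field g h p).

Definition energy (R : realType) (n : nat) (g : metric R n)
    (p : 'rV[R]_(n + n)) : R :=
  2^-1 * g (lsubmx p) (rsubmx p) (rsubmx p).

Definition first_integral (R : realType) (n : nat) (g : metric R n)
    (f : 'rV[R]_(n + n) -> R) : Prop :=
  smooth f /\ forall p, poisson g f (energy g) p = 0.

Definition completely_integrable (R : realType) (n : nat) (g : metric R n) :
    Prop :=
  exists f : 'I_n -> 'rV[R]_(n + n) -> R,
    [/\ forall i, first_integral g (f i),
        forall i j p, poisson g (f i) (f j) p = 0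
      & exists U : set 'rV[R]_(n + n),
          [/\ open U, dense U
            & forall p, U p -> row_free (\matrix_i gradient (f i) p)]].

(** * The group N_{K_3}

   The Lie algebra is R^(3 + 3), with standard basis V_0, V_1, V_2, Z_0, Z_1,
   Z_2.  The indices lie in ['I_3] = Z/3, so that the relations [V_1,V_2]=Z_1,
   [V_2,V_3]=Z_2, [V_3,V_1]=Z_3 read [V_i, V_(i+1)] = Z_i. *)

Definition V (R : realType) (i : 'I_3) : 'rV[R]_(3 + 3) :=
  delta_mx 0 (lshift 3 i).

Definition Z (R : realType) (i : 'I_3) : 'rV[R]_(3 + 3) :=
  delta_mx 0 (rshift 3 i).

Definition bracket (R : realType) (x y : 'rV[R]_(3 + 3)) : 'rV[R]_(3 + 3) :=
  let v := fun (w : 'rV[R]_(3 + 3)) (i : 'I_3) => w 0 (lshift 3 i) in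
  \sum_(i < 3) (v x i * v y (i + 1) - v x (i + 1) * v y i) *: Z R i.

(* A simply connected nilpotent Lie group is identified with its Lie algebra by
   the exponential map, and the product is then given by the
   Baker-Campbell-Hausdorff formula, which stops at the first bracket for a
   2-step nilpotent algebra. *)
Definition NK3_mul (R : realType) (x y : 'rV[R]_(3 + 3)) : 'rV[R]_(3 + 3) :=
  x + y + 2^-1 *: bracket x y.

Definition NK3_inv (R : realType) (x : 'rV[R]_(3 + 3)) : 'rV[R]_(3 + 3) := - x.

(* the differential at x of the left translation by the inverse of x *)
Definition NK3_to_identity (R : realType) (x u : 'rV[R]_(3 + 3)) :
    'rV[R]_(3 + 3) :=
  'D_u (NK3_mul (NK3_inv x)) x.

(* V_0, V_1, V_2, Z_0, Z_1, Z_2 is the standard basis, so that the inner product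
   at the identity is the dot product. *)
Definition NK3_metric (R : realType) : metric R (3 + 3) :=
  fun x u w => (NK3_to_identity x u *m (NK3_to_identity x w)^T) 0 0.

Section NK3Theory.
Variable R : realType.
Implicit Types (x y z u w : 'rV[R]_(3 + 3)) (i j : 'I_3).

Lemma bracket_lshift x y i : bracket x y 0 (lshift 3 i) = 0.
Proof.
rewrite /bracket summxE big1 // => j _.
by rewrite !mxE eqxx /= eq_lrshift mulr0.
Qed.

Lemma bracket_rshift x y i : bracket x y 0 (rshift 3 i) =
  x 0 (lshift 3 i) * y 0 (lshift 3 (i + 1)) -
  x 0 (lshift 3 (i + 1)) * y 0 (lshift 3 i).
Proof.
rewrite /bracket summxE (bigD1 i) //= big1 ?addr0 => [|j ji].
  by rewrite !mxE !eqxx mulr1.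
by rewrite !mxE eqxx /= eq_rshift eq_sym (negPf ji) mulr0.
Qed.

Lemma rV33P x y :
  (forall i, x 0 (lshift 3 i) = y 0 (lshift 3 i)) ->
  (forall i, x 0 (rshift 3 i) = y 0 (rshift 3 i)) -> x = y.
Proof.
move=> el er; apply/rowP => k.
by case: (split_ordP k) => i ->; [exact: el | exact: er].
Qed.

Lemma bracketVV i : bracket (V R i) (V R (i + 1)) = Z R i.
Proof.
apply: rV33P => k; first by rewrite bracket_lshift !mxE eqxx /= eq_lrshift.
rewrite bracket_rshift !mxE !eqxx /= !eq_lshift !eq_rshift.
by case: i => -[|[|[|//]]] ?; case: k => -[|[|[|//]]] ?;
  rewrite /= ?mulr0 ?mulr1 ?subr0.
Qed.

Lemma bracketZ_center x i : bracket (Z R i) x = 0.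
Proof.
apply: rV33P => k; rewrite [RHS]mxE ?bracket_lshift // bracket_rshift.
by rewrite !mxE !eq_lrshift !mul0r subr0.
Qed.

Lemma bracketC x y : bracket y x = - bracket x y.
Proof.
apply: rV33P => i; rewrite [RHS]mxE ?bracket_lshift ?oppr0 // !bracket_rshift.
by ring.
Qed.

Lemma bracketDl x y z : bracket (x + y) z = bracket x z + bracket y z.
Proof.
apply: rV33P => i; rewrite [RHS]mxE ?bracket_lshift ?addr0 // !bracket_rshift.
by rewrite !mxE; ring.
Qed.

Lemma bracketZl (c : R) x z : bracket (c *: x) z = c *: bracket x z.
Proof.
apply: rV33P => i; rewrite [RHS]mxE ?bracket_lshift ?mulr0 // !bracket_rshift.
by rewrite !mxE; ring.
Qed.

Lemma bracketNl x y : bracket (- x) y = - bracket x y.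
Proof. by rewrite -scaleN1r bracketZl scaleN1r. Qed.

Lemma bracketDr x y z : bracket z (x + y) = bracket z x + bracket z y.
Proof. by rewrite bracketC bracketDl opprD -!bracketC. Qed.

Lemma bracketZr (c : R) x z : bracket z (c *: x) = c *: bracket z x.
Proof. by rewrite bracketC bracketZl -scalerN -bracketC. Qed.

Lemma bracket_center x y z : bracket (bracket x y) z = 0.
Proof.
apply: rV33P => i; rewrite [RHS]mxE ?bracket_lshift // bracket_rshift.
by rewrite !bracket_lshift !mul0r subr0.
Qed.

Lemma bracketxx x : bracket x x = 0.
Proof.
apply: rV33P => i; rewrite [RHS]mxE ?bracket_lshift // bracket_rshift.
by ring.
Qed.

Lemma NK3_mulA x y z :
  NK3_mul x (NK3_mul y z) = NK3_mul (NK3_mul x y) z.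
Proof.
rewrite /NK3_mul !(bracketDl, bracketDr, bracketZl, bracketZr).
rewrite bracket_center (bracketC (bracket y z) x) bracket_center oppr0.
rewrite !scaler0 !addr0 !scalerDr; apply/rowP => k; rewrite !mxE; ring.
Qed.

Lemma NK3_mul0 x : NK3_mul x 0 = x.
Proof. by rewrite /NK3_mul -(scale0r x) bracketZr !scale0r scaler0 !addr0. Qed.

Lemma NK3_0mul x : NK3_mul 0 x = x.
Proof.
by rewrite /NK3_mul -(scale0r x) bracketZl !scale0r scaler0 add0r addr0.
Qed.

Lemma NK3_mulV x : NK3_mul x (NK3_inv x) = 0.
Proof.
by rewrite /NK3_mul /NK3_inv -scaleN1r bracketZr bracketxx !scaler0
  scaleN1r subrr addr0.
Qed.

Lemma NK3_Vmul x : NK3_mul (NK3_inv x) x = 0.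
Proof.
by rewrite /NK3_mul /NK3_inv -scaleN1r bracketZl bracketxx !scaler0
  scaleN1r addNr addr0.
Qed.

Lemma derive_NK3_mul (a x u : 'rV[R]_(3 + 3)) :
  'D_u (NK3_mul a) x = u + 2^-1 *: bracket a u.
Proof.
rewrite /derive; apply: cvg_lim => //.
apply: cvg_near_cst; near=> h.
have h0 : h != 0 by near: h; exact: nbhs_dnbhs_neq.
rewrite /= /NK3_mul bracketDr bracketZr.
apply/rowP => k; rewrite !mxE; field.
by rewrite h0.
Unshelve. all: by end_near. Qed.

Lemma NK3_metric_left_invariant (a x u w : 'rV[R]_(3 + 3)) :
  NK3_metric (NK3_mul a x) ('D_u (NK3_mul a) x) ('D_w (NK3_mul a) x) =
  NK3_metric x u w.
Proof.
have E b : NK3_to_identity (NK3_mul a x) ('D_b (NK3_mul a) x) =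
    NK3_to_identity x b.
  rewrite /NK3_to_identity !derive_NK3_mul /NK3_inv /NK3_mul.
  rewrite !(bracketNl, bracketDl, bracketDr, bracketZl, bracketZr).
  rewrite !bracket_center (bracketC (bracket a b) a).
  rewrite (bracketC (bracket a b) x) !bracket_center.
  by apply/rowP => k; rewrite !mxE; field.
exact: (congr2 (fun p q : 'rV[R]_(3 + 3) => (p *m q^T) 0 0) (E u) (E w)).
Qed.

Lemma NK3_metric_orthonormal (i j : 'I_(3 + 3)) :
  @NK3_metric R 0 (delta_mx 0 i) (delta_mx 0 j) = (i == j)%:R.
Proof.
rewrite /NK3_metric /NK3_to_identity !derive_NK3_mul /NK3_inv oppr0.
rewrite -(scale0r (0 : 'rV[R]_(3 + 3))) !bracketZl !scale0r scaler0 !addr0.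
by rewrite trmx_delta mul_delta_mx_cond; case: (i == j); rewrite ?mulr1n ?mulr0n !mxE ?eqxx.
Qed.

(* The left-invariant fields x |-> 'D_u (NK3_mul x) 0 form the Lie algebra
   ['rV_(3 + 3)] with [bracket]. *)
Lemma NK3_lie_algebra (u w x : 'rV[R]_(3 + 3)) :
  let X u x := 'D_u (NK3_mul x) 0 in
  'D_(X u x) (X w) x - 'D_(X w x) (X u) x = X (bracket u w) x.
Proof.
move=> X.
have XE c y : X c y = c + 2^-1 *: bracket y c by exact: derive_NK3_mul.
have D b c y : 'D_b (X c) y = 2^-1 *: bracket b c.
  rewrite (_ : X c = fun y => c + 2^-1 *: bracket y c); last exact/funext.
  rewrite /derive; apply: cvg_lim => //.
  apply: cvg_near_cst; near=> h.
  have h0 : h != 0 by near: h; exact: nbhs_dnbhs_neq.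
  rewrite /= bracketDl bracketZl.
  by apply/rowP => k; rewrite !mxE; field; rewrite h0.
clearbody X; rewrite !D !XE !bracketDl !bracketZl !bracket_center.
rewrite (bracketC u w) (bracketC (bracket u w) x) bracket_center.
by apply/rowP => k; rewrite !mxE; field.
Unshelve. all: by end_near. Qed.

End NK3Theory.

(* Main.v *)
(** Left translation turns a tangent vector (q, v) into the body velocity
    Y = v - [q, v] / 2 in the Lie algebra.  If (A, B) are the components of a
    vector tangent to TN, A being its left-translated position part and B the
    induced variation of Y, the symplectic form is
      omega((A, B), (A', B')) = <B', A> - <B, A'> + <Y, [A, A']>.
    Write Y = (v_0, v_1, v_2, z_0, z_1, z_2).  The following six functions are
    in involution: the z_i, which are central; the Casimir
    sum_i v_i z_(i+1); the energy; and the momentum <Y, V_0 - [q, V_0]> of the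
    right-invariant field V_0, which commutes with every function of Y.  Their
    Hamiltonian vectors are (Z_i, 0), (C Y, 0), (Y, ad_Y^* Y) and
    (V_0 - [q, V_0], 0).  Pairing a vanishing combination of the gradients with
    suitable vectors (A, B) kills the coefficients one after the other as soon
    as z_0 and z_0 v_0 - z_1 v_2 do not vanish. *)

From HB Require Import structures.
Require Import Defs.
From mathcomp Require Import all_boot all_order all_algebra.
From mathcomp Require Import all_classical all_reals all_analysis.
From mathcomp Require Import ring.

Set Implicit Arguments.
Unset Strict Implicit.
Unset Printing Implicit Defensive.

Import Order.TTheory GRing.Theory Num.Theory.
Import numFieldNormedType.Exports.

Local Open Scope classical_set_scope.
Local Open Scope ring_scope.

(** * Closure properties of smooth functions on R^m *)

Section Smooth.
Variables (R : realType) (m : nat).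
Implicit Types f g : 'rV[R]_m -> R.

Lemma C_cst k (c : R) : C_ k (fun _ : 'rV[R]_m => c).
Proof.
elim: k c => [|k IHk] c /=; first exact: cst_continuous.
split=> [p|u]; first exact: differentiable_cst.
rewrite (_ : (fun p => _) = fun _ : 'rV[R]_m => (0 : R)).
  exact: IHk.
by apply/funext => p; exact: derive_cst.
Qed.

(** Needed for products: the derivative of f g contains f and g undifferentiated, and the induction
    wants these at class k. *)
Lemma C_pred k f : C_ k.+1 f -> C_ k f.
Proof.
elim: k f => [|k IHk] f [df Df] /=.
  by move=> p; exact: differentiable_continuous.
by split=> // u; exact: IHk (Df u).
Qed.

Lemma C_D k f g : C_ k f -> C_ k g -> C_ k (fun p => f p + g p).
Proof.
elim: k f g => [|k IHk] f g.
  by move=> cf cg p; apply: continuousD; [exact: cf | exact: cg].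
move=> [df Df] [dg Dg]; split=> [p|u]; first exact: differentiableD.
rewrite (_ : (fun p => _) = fun p => 'D_u f p + 'D_u g p).
  by apply: IHk; [exact: Df | exact: Dg].
by apply/funext => p; apply: deriveD; exact: diff_derivable.
Qed.

Lemma C_M k f g : C_ k f -> C_ k g -> C_ k (fun p => f p * g p).
Proof.
elim: k f g => [|k IHk] f g.
  by move=> cf cg p; apply: continuousM; [exact: cf | exact: cg].
move=> Cf Cg; have [[df Df] [dg Dg]] := (Cf, Cg).
split=> [p|u]; first exact: differentiableM.
rewrite (_ : (fun p => _) = fun p => f p * 'D_u g p + g p * 'D_u f p).
  apply: C_D; apply: IHk.
  - exact: C_pred.
  - exact: Dg.
  - exact: C_pred.
  - exact: Df.
by apply/funext => p; apply: deriveM; exact: diff_derivable.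
Qed.

Lemma is_derive_coord0 (j : 'I_m) (p u : 'rV[R]_m) :
  is_derive p u (fun q : 'rV[R]_m => q 0 j) (u 0 j).
Proof.
apply: DeriveDef; first exact/diff_derivable/differentiable_coord.
(* The identity has derivative u, and its coordinates are the functions in question. *)
have := derive_mx (@ex_derive _ _ _ _ _ _ _ (is_derive_id p u)).
by rewrite derive_val => {2}->; rewrite mxE.
Qed.

Lemma smooth_cst (c : R) : smooth (fun _ : 'rV[R]_m => c).
Proof. by move=> k; exact: C_cst. Qed.

Lemma smoothD f g : smooth f -> smooth g -> smooth (fun p => f p + g p).
Proof. by move=> sf sg k; exact: C_D. Qed.

Lemma smoothM f g : smooth f -> smooth g -> smooth (fun p => f p * g p).
Proof. by move=> sf sg k; exact: C_M. Qed.

Lemma smooth_sum n (F : 'I_n -> 'rV[R]_m -> R) :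
  (forall i, smooth (F i)) -> smooth (fun p => \sum_i F i p).
Proof.
move=> sF; rewrite (_ : (fun p => _) = \sum_i F i).
  elim/big_ind: _ => [|f g sf sg|i _]; last exact: sF.
    exact: smooth_cst.
  exact: smoothD.
by apply/funext => p; rewrite fct_sumE.
Qed.

Lemma smooth_coord (j : 'I_m) : smooth (fun p : 'rV[R]_m => p 0 j).
Proof.
case=> [|k] /=; first by move=> p; exact: coord_continuous.
split=> [p|u]; first exact: differentiable_coord.
rewrite (_ : (fun p => _) = fun=> u 0 j); first exact: C_cst.
by apply/funext => p; apply: derive_val; exact: is_derive_coord0.
Qed.

Lemma smooth_continuous f : smooth f -> continuous f.
Proof. by move=> /(_ 0%N). Qed.

End Smooth.

(** * Entrywise derivatives, and the dot product *)

Section MatrixDerivative.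
Variables (R : realType) (U : normedModType R) (m n : nat).
Implicit Types (M : U -> 'M[R]_(m, n)) (p b : U).

Lemma is_derive_mx M p b (dM : 'M[R]_(m, n)) :
  (forall i j, is_derive p b (fun x => M x i j) (dM i j)) -> is_derive p b M dM.
Proof.
move=> dMij; have dvM : derivable M p b.
  by apply/derivable_mxP => i j; exact: (@ex_derive _ _ _ _ _ _ _ (dMij i j)).
apply: DeriveDef => //; rewrite derive_mx //; apply/matrixP => i j.
by rewrite mxE; exact: (@derive_val _ _ _ _ _ _ _ (dMij i j)).
Qed.

Lemma is_derive_coord M p b (dM : 'M[R]_(m, n)) i j :
  is_derive p b M dM -> is_derive p b (fun x => M x i j) (dM i j).
Proof.
case=> dvM <-; apply: DeriveDef; first exact: (derivable_mxP _ _ _).1.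
by rewrite derive_mx // mxE.
Qed.

End MatrixDerivative.

HB.lock Definition dot (R : realType) (n : nat) (x y : 'rV[R]_n) : R :=
  (x *m y^T) 0 0.

Section Dot.
Variables (R : realType) (n : nat).
Implicit Types x y z : 'rV[R]_n.

Lemma dotE x y : dot x y = \sum_i x 0 i * y 0 i.
Proof. by rewrite dot.unlock mxE; apply: eq_bigr => i _; rewrite mxE. Qed.

Lemma dotC x y : dot x y = dot y x.
Proof. by rewrite !dotE; apply: eq_bigr => i _; rewrite mulrC. Qed.

Lemma dotDl x y z : dot (x + y) z = dot x z + dot y z.
Proof. by rewrite dot.unlock mulmxDl mxE. Qed.

Lemma dotZl (c : R) x y : dot (c *: x) y = c * dot x y.
Proof. by rewrite dot.unlock -scalemxAl mxE. Qed.

Lemma dotNl x y : dot (- x) y = - dot x y.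
Proof. by rewrite dot.unlock mulNmx mxE. Qed.

Lemma dot0l y : dot 0 y = 0.
Proof. by rewrite dot.unlock mul0mx mxE. Qed.

Lemma dotDr x y z : dot z (x + y) = dot z x + dot z y.
Proof. by rewrite dotC dotDl !(dotC z). Qed.

Lemma dotZr (c : R) x y : dot y (c *: x) = c * dot y x.
Proof. by rewrite dotC dotZl (dotC y). Qed.

Lemma dotNr x y : dot y (- x) = - dot y x.
Proof. by rewrite dotC dotNl (dotC y). Qed.

Lemma dot0r y : dot y 0 = 0.
Proof. by rewrite dotC dot0l. Qed.

Lemma dot_delta x i : dot (delta_mx 0 i) x = x 0 i.
Proof. by rewrite dot.unlock -rowE !mxE. Qed.

Lemma dot_mulmx k x (a : 'rV[R]_k) (M : 'M[R]_(k, n)) :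
  dot x (a *m M) = \sum_i a 0 i * dot x (row i M).
Proof.
rewrite dotC {1}dot.unlock -mulmxA mxE; apply: eq_bigr => i _; congr (_ * _).
by rewrite dotC dot.unlock -row_mul [RHS]mxE.
Qed.

Lemma dotxx_eq0 x : dot x x = 0 -> x = 0.
Proof.
rewrite dotE => /eqP; rewrite psumr_eq0 => [/allP x0|i _]; last first.
  by rewrite -expr2 sqr_ge0.
apply/rowP => i; rewrite mxE.
by have := x0 i (mem_index_enum i); rewrite mulf_eq0 orbb => /eqP.
Qed.

(** Expand x in the standard basis. This turns rows of basis values (the covector of [flat], a
    product with [symplectic_mx], a gradient) back into linear functionals. *)
Lemma dot_row_linear (l : 'rV[R]_n -> R) x :
  (forall c y z, l (c *: y + z) = c * l y + l z) ->
  dot x (\row_i l (delta_mx 0 i)) = l x.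
Proof.
(* The value at 0 comes from c = -1 and y = z = 0. *)
move=> lin; have l0 : l 0 = 0.
  by have := lin (-1) 0 0; rewrite scaler0 addr0 mulN1r addNr.
rewrite dotE {2}(row_sum_delta x).
rewrite [RHS](_ : _ = \sum_i x 0 i * l (delta_mx 0 i)).
  by apply: eq_bigr => i _; rewrite mxE.
elim/big_rec2: _ => [//|i y z _ IH]; first by rewrite lin IH.
Qed.

Lemma is_derive_dot (W : normedModType R) (G H : W -> 'rV[R]_n) (p b : W)
    dG dH :
  is_derive p b G dG -> is_derive p b H dH ->
  is_derive p b (fun q => dot (G q) (H q)) (dot dG (H p) + dot (G p) dH).
Proof.
move=> dGp dHp; rewrite (_ : (fun q => _) =
    \sum_i ((fun q => G q 0 i) * (fun q => H q 0 i))); last first.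
  by apply/funext => x; rewrite fct_sumE dotE.
apply: is_derive_eq.
  apply: is_derive_sum => i; apply: is_deriveM; exact: is_derive_coord.
rewrite !dotE -big_split; apply: eq_bigr => i _ /=.
by rewrite /GRing.scale /=; ring.
Qed.

End Dot.

Lemma smooth_dot (R : realType) (m n : nat) (G H : 'rV[R]_m -> 'rV[R]_n) :
  (forall j, smooth (fun p => G p 0 j)) ->
  (forall j, smooth (fun p => H p 0 j)) ->
  smooth (fun p => dot (G p) (H p)).
Proof.
move=> sG sH; rewrite (_ : (fun p => _) = fun p => \sum_i G p 0 i * H p 0 i).
  by apply: smooth_sum => i; exact: smoothM.
by apply/funext => p; rewrite dotE.
Qed.

(** A point of the open set A stays in A and in a given open set after a small move, while every
    nonzero move along b lands in B. Applied twice, this imposes two nonvanishing conditions one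
    after the other. *)
Lemma dense_line_perturb (R : realType) (W : normedModType R) (A B : set W) :
  open A -> dense A ->
  (forall p, A p -> B p \/ exists b, forall t : R, t != 0 -> B (p + t *: b)) ->
  dense (A `&` B).
Proof.
move=> oA dA AB O O0 oO.
have [p [Op Ap]] := dA O O0 oO.
have [Bp|[b Bb]] := AB p Ap; first by exists p.
have cvgp : p + t *: b @[t --> (0 : R)] --> p.
  rewrite -[X in _ --> X]addr0 -(scale0r b); apply: cvgD; first exact: cvg_cst.
  by apply: cvgZr_tmp; exact: cvg_id.
near (0 : R)^' => t.
have t0 : t != 0 by near: t; exact: nbhs_dnbhs_neq.
have [Ot At] : (O `&` A) (p + t *: b).
  near: t; apply: nbhs_dnbhs; apply: cvgp.
  by apply: open_nbhs_nbhs; split; [exact: openI | split].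
by exists (p + t *: b); split => //; split => //; exact: Bb.
Unshelve. all: by end_near. Qed.

(** * Left trivialization of the tangent bundle *)

HB.lock Definition translate (R : realType) (q u : 'rV[R]_(3 + 3)) :
    'rV[R]_(3 + 3) :=
  u - 2^-1 *: bracket q u.

HB.lock Definition untranslate (R : realType) (q u : 'rV[R]_(3 + 3)) :
    'rV[R]_(3 + 3) :=
  u + 2^-1 *: bracket q u.

HB.lock Definition body_velocity (R : realType)
    (p : 'rV[R]_(3 + 3 + (3 + 3))) : 'rV[R]_(3 + 3) :=
  translate (lsubmx p) (rsubmx p).

HB.lock Definition body_velocity_diff (R : realType)
    (p b : 'rV[R]_(3 + 3 + (3 + 3))) : 'rV[R]_(3 + 3) :=
  translate (lsubmx p) (rsubmx b) - 2^-1 *: bracket (lsubmx b) (rsubmx p).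

(* The tangent vector at [p] with left-translated position part [A] and body
   velocity variation [B]. *)
HB.lock Definition frame (R : realType) (p : 'rV[R]_(3 + 3 + (3 + 3)))
    (A B : 'rV[R]_(3 + 3)) : 'rV[R]_(3 + 3 + (3 + 3)) :=
  row_mx (untranslate (lsubmx p) A)
    (untranslate (lsubmx p)
       (B + 2^-1 *: bracket (untranslate (lsubmx p) A) (rsubmx p))).

Section NK3.
Variable R : realType.
Local Notation n := (3 + 3)%N.
Implicit Types (u x y : 'rV[R]_n) (p b : 'rV[R]_(n + n)).

Lemma bracket0r x : bracket x 0 = 0 :> 'rV[R]_n.
Proof. by rewrite -(scale0r (0 : 'rV[R]_n)) bracketZr !scale0r. Qed.

Lemma bracket0l x : bracket 0 x = 0 :> 'rV[R]_n.
Proof. by rewrite bracketC bracket0r oppr0. Qed.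

Lemma bracket_bracket_r x y u : bracket x (bracket y u) = 0.
Proof. by rewrite bracketC bracket_center oppr0. Qed.

Lemma bracketZ_central x i : bracket x (Z R i) = 0.
Proof. by rewrite bracketC bracketZ_center oppr0. Qed.

(** The algebra is 2-step, so the second-order term [q, [q, u]] vanishes. *)
Lemma translateK (q : 'rV[R]_n) : cancel (translate q) (untranslate q).
Proof.
move=> u; rewrite translate.unlock untranslate.unlock bracketDr -scaleNr.
rewrite bracketZr.
by rewrite bracket_bracket_r scaler0 addr0 scaleNr subrK.
Qed.

Lemma untranslateK (q : 'rV[R]_n) : cancel (untranslate q) (translate q).
Proof.
move=> u; rewrite translate.unlock untranslate.unlock bracketDr bracketZr.
by rewrite bracket_bracket_r scaler0 addr0 addrK.
Qed.

Lemma translateP (q : 'rV[R]_n) (c : R) x y :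
  translate q (c *: x + y) = c *: translate q x + translate q y.
Proof.
rewrite translate.unlock bracketDr bracketZr.
by apply/rowP => k; rewrite !mxE; ring.
Qed.

(** Translation only adds a central vector. Hence brackets of position components may be taken
    before or after translation. *)
Lemma bracket_translate (q : 'rV[R]_n) x y :
  bracket x (translate q y) = bracket x y.
Proof.
rewrite translate.unlock bracketDr -scaleNr bracketZr.
by rewrite bracket_bracket_r scaler0 addr0.
Qed.

Lemma NK3_to_identityE (q : 'rV[R]_n) u : NK3_to_identity q u = translate q u.
Proof.
rewrite translate.unlock /NK3_to_identity derive_NK3_mul /NK3_inv.
by rewrite bracketNl scalerN.
Qed.

Local Notation Y := (@body_velocity R).
Local Notation dY := (@body_velocity_diff R).

(** * Derivatives of the body velocity and of the map to T*M *)

Lemma is_derive_lsubmx p b :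
  is_derive p b (lsubmx : 'rV[R]_(n + n) -> 'rV[R]_n) (lsubmx b).
Proof.
apply: is_derive_mx => i j; rewrite (_ : (fun r => _) =
  fun r : 'rV[R]_(n + n) => r i (lshift n j)); last first.
  by apply/funext => x; rewrite mxE.
by rewrite mxE ord1; exact: is_derive_coord0.
Qed.

Lemma is_derive_rsubmx p b :
  is_derive p b (rsubmx : 'rV[R]_(n + n) -> 'rV[R]_n) (rsubmx b).
Proof.
apply: is_derive_mx => i j; rewrite (_ : (fun r => _) =
  fun r : 'rV[R]_(n + n) => r i (rshift n j)); last first.
  by apply/funext => x; rewrite mxE.
by rewrite mxE ord1; exact: is_derive_coord0.
Qed.

Lemma is_derive_bracket (G H : 'rV[R]_(n + n) -> 'rV[R]_n) p b dG dH :
  is_derive p b G dG -> is_derive p b H dH ->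
  is_derive p b (fun q => bracket (G q) (H q))
    (bracket dG (H p) + bracket (G p) dH).
Proof.
move=> dGp dHp; apply: is_derive_mx => i j; rewrite ord1 {i}.
case: (split_ordP j) => i ->; rewrite mxE ?bracket_lshift ?bracket_rshift.
  rewrite (_ : (fun q => _) = cst 0).
    by rewrite addr0; exact: is_derive_cst.
  by apply/funext => q; rewrite bracket_lshift.
rewrite (_ : (fun q => _) =
  (fun q => G q 0 (lshift 3 i)) * (fun q => H q 0 (lshift 3 (i + 1))) -
  (fun q => G q 0 (lshift 3 (i + 1))) * (fun q => H q 0 (lshift 3 i)));
  last first.
  by apply/funext => q; rewrite bracket_rshift.
apply: is_derive_eq.
  by apply: is_deriveB; apply: is_deriveM; exact: is_derive_coord.
by rewrite /GRing.scale /=; ring.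
Qed.

Lemma is_derive_translate (G H : 'rV[R]_(n + n) -> 'rV[R]_n) p b dG dH :
  is_derive p b G dG -> is_derive p b H dH ->
  is_derive p b (fun q => translate (G q) (H q))
    (translate (G p) dH - 2^-1 *: bracket dG (H p)).
Proof.
move=> dGp dHp; rewrite translate.unlock; apply: is_derive_eq.
  by apply: is_deriveB; apply: is_deriveZ; exact: is_derive_bracket.
by rewrite scalerDr opprD addrA addrAC.
Qed.

Lemma is_derive_body_velocity p b : is_derive p b Y (dY p b).
Proof.
rewrite body_velocity_diff.unlock (_ : Y =
  fun r => translate (lsubmx r) (rsubmx r)).
  exact: is_derive_translate (is_derive_lsubmx p b) (is_derive_rsubmx p b).
by apply/funext => r; rewrite body_velocity.unlock.
Qed.

Lemma body_velocity_diffP p (c : R) b b' :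
  dY p (c *: b + b') = c *: dY p b + dY p b'.
Proof.
rewrite body_velocity_diff.unlock !linearP /= translateP bracketDl bracketZl.
by apply/rowP => k; rewrite !mxE; ring.
Qed.

Lemma flatE : flat (@NK3_metric R) = fun p =>
  row_mx (lsubmx p) (\row_i dot (Y p) (translate (lsubmx p) (delta_mx 0 i))).
Proof.
apply/funext => p; rewrite /flat; congr row_mx; apply/rowP => i.
by rewrite !mxE /NK3_metric !NK3_to_identityE body_velocity.unlock dot.unlock.
Qed.

Lemma derive_flat p b : 'D_b (flat (@NK3_metric R)) p =
  row_mx (lsubmx b)
    (\row_i (dot (dY p b) (translate (lsubmx p) (delta_mx 0 i)) -
             2^-1 * dot (Y p) (bracket (lsubmx b) (delta_mx 0 i)))).
Proof.
rewrite flatE; apply: derive_val; apply: is_derive_mx => i j; rewrite ord1 {i}.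
case: (split_ordP j) => i ->; rewrite ?row_mxEl ?row_mxEr.
  rewrite (_ : (fun q => _) = fun q => (lsubmx q : 'rV[R]_n) 0 i).
    by apply: is_derive_coord; exact: is_derive_lsubmx.
  by apply/funext => q; rewrite row_mxEl.
rewrite mxE (_ : (fun q => _) =
    fun q => dot (Y q) (translate (lsubmx q) (delta_mx 0 i))); last first.
  by apply/funext => q; rewrite row_mxEr mxE.
apply: is_derive_eq.
  apply: is_derive_dot; first exact: is_derive_body_velocity.
  by apply: is_derive_translate; exact: is_derive_lsubmx.
(* The basis vector is constant, so only the dependence of [translate] on the base point
   contributes. *)
by rewrite translate.unlock bracket0r scaler0 subrr sub0r dotNr dotZr.
Qed.

Lemma canonical_formE (x y u v : 'rV[R]_n) :
  canonical_form (row_mx x u) (row_mx y v) = dot x v - dot y u.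
Proof.
rewrite (dotC y) dot.unlock /canonical_form !row_mxKl !row_mxKr.
by rewrite mxE [in X in _ + X]mxE.
Qed.

(** * Smoothness of the body velocity *)

Lemma smooth_bracket (G H : 'rV[R]_(n + n) -> 'rV[R]_n) :
  (forall j, smooth (fun p => G p 0 j)) ->
  (forall j, smooth (fun p => H p 0 j)) ->
  forall j, smooth (fun p => bracket (G p) (H p) 0 j).
Proof.
move=> sG sH j; case: (split_ordP j) => i ->.
  rewrite (_ : (fun p => _) = fun=> 0); first exact: smooth_cst.
  by apply/funext => p; rewrite bracket_lshift.
rewrite (_ : (fun p => _) = fun p =>
  G p 0 (lshift 3 i) * H p 0 (lshift 3 (i + 1)) +
  (-1) * (G p 0 (lshift 3 (i + 1)) * H p 0 (lshift 3 i))).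
  by apply: smoothD; [|apply: smoothM; first exact: smooth_cst]; exact: smoothM.
by apply/funext => p; rewrite bracket_rshift mulN1r.
Qed.

Lemma smooth_lsubmx j : smooth (fun p => (lsubmx p : 'rV[R]_n) 0 j).
Proof.
rewrite (_ : (fun p => _) = fun p => p 0 (lshift n j)).
  exact: smooth_coord.
by apply/funext => p; rewrite mxE.
Qed.

Lemma smooth_rsubmx j : smooth (fun p => (rsubmx p : 'rV[R]_n) 0 j).
Proof.
rewrite (_ : (fun p => _) = fun p => p 0 (rshift n j)).
  exact: smooth_coord.
by apply/funext => p; rewrite mxE.
Qed.

Lemma smooth_body_velocity j : smooth (fun p => Y p 0 j).
Proof.
rewrite (_ : (fun p => _) = fun p => (rsubmx p : 'rV[R]_n) 0 j +
  (- 2^-1) * bracket (lsubmx p) (rsubmx p) 0 j).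
  apply: smoothD; first exact: smooth_rsubmx.
  apply: smoothM; first exact: smooth_cst.
  by apply: smooth_bracket; [exact: smooth_lsubmx | exact: smooth_rsubmx].
by apply/funext => p; rewrite body_velocity.unlock translate.unlock !mxE mulNr.
Qed.

Lemma energyE :
  energy (@NK3_metric R) = fun p => 2^-1 * dot (Y p) (Y p).
Proof.
apply/funext => p; rewrite /energy /NK3_metric !NK3_to_identityE.
by rewrite body_velocity.unlock dot.unlock.
Qed.

(** * The components (A, B) of a tangent vector, and the symplectic form in them *)

Lemma translate_frame p A B :
  translate (lsubmx p) (lsubmx (frame p A B)) = A.
Proof. by rewrite frame.unlock row_mxKl untranslateK. Qed.

(** The bracket added to B in [frame] compensates the change of Y due to moving the base point. *)
Lemma body_velocity_diff_frame p A B : dY p (frame p A B) = B.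
Proof.
rewrite body_velocity_diff.unlock frame.unlock row_mxKl row_mxKr untranslateK.
by rewrite addrK.
Qed.

Lemma frameK p b : frame p (translate (lsubmx p) (lsubmx b)) (dY p b) = b.
Proof.
rewrite frame.unlock body_velocity_diff.unlock translateK subrK translateK.
by rewrite hsubmxK.
Qed.

Lemma frame00 p : frame p 0 0 = 0.
Proof.
have T0 (q : 'rV[R]_n) : untranslate q 0 = 0
    by rewrite untranslate.unlock bracket0r scaler0 addr0.
by rewrite frame.unlock T0 bracket0l scaler0 addr0 T0 row_mx0.
Qed.

(** At a fixed base point Y is linear in the velocity. These fibre lines serve as the perturbations
    in the density argument. *)
Lemma body_velocity_line p x (t : R) :
  Y (p + t *: row_mx 0 (untranslate (lsubmx p) x)) = Y p + t *: x.
Proof.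
rewrite body_velocity.unlock !linearD !linearZ /= row_mxKl row_mxKr.
rewrite scaler0 addr0 addrC.
by rewrite translateP untranslateK addrC.
Qed.

(** Each of the two covector pairings contributes half of the bracket term, and by antisymmetry the
    halves add up. By [bracket_translate] the untranslated positions in the bracket do no harm. *)
Lemma symplectic_formE p b b' : symplectic_form (@NK3_metric R) p b b' =
  dot (dY p b') (translate (lsubmx p) (lsubmx b)) -
  dot (dY p b) (translate (lsubmx p) (lsubmx b')) +
  dot (Y p) (bracket (lsubmx b) (lsubmx b')).
Proof.
rewrite /symplectic_form !derive_flat canonical_formE.
have covector (x c : 'rV[R]_n) a : dot x
    (\row_i (dot c (translate (lsubmx p) (delta_mx 0 i)) -
             2^-1 * dot (Y p) (bracket a (delta_mx 0 i)))) =
    dot c (translate (lsubmx p) x) - 2^-1 * dot (Y p) (bracket a x).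
  apply: (dot_row_linear (l := fun x => dot c (translate (lsubmx p) x) -
             2^-1 * dot (Y p) (bracket a x))) => k y z.
  by rewrite translateP bracketDr bracketZr !(dotDr, dotZr); ring.
rewrite !covector [in X in X - _](bracketC (lsubmx b)) dotNr.
by field.
Qed.

Lemma symplectic_formPl p (c : R) b b' b'' :
  symplectic_form (@NK3_metric R) p (c *: b + b') b'' =
  c * symplectic_form (@NK3_metric R) p b b'' +
  symplectic_form (@NK3_metric R) p b' b''.
Proof.
rewrite !symplectic_formE body_velocity_diffP !linearP /= translateP.
by rewrite bracketDl bracketZl !(dotDl, dotZl, dotDr, dotZr); ring.
Qed.

Lemma symplectic_formPr p (c : R) b b' b'' :
  symplectic_form (@NK3_metric R) p b'' (c *: b + b') =
  c * symplectic_form (@NK3_metric R) p b'' b +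
  symplectic_form (@NK3_metric R) p b'' b'.
Proof.
rewrite !symplectic_formE body_velocity_diffP !linearP /= translateP.
by rewrite bracketDr bracketZr !(dotDl, dotZl, dotDr, dotZr); ring.
Qed.

Lemma mul_symplectic_mx p b : b *m symplectic_mx (@NK3_metric R) p =
  \row_j symplectic_form (@NK3_metric R) p b (delta_mx 0 j).
Proof.
apply/rowP => j; rewrite [RHS]mxE -(dot_row_linear (l := fun b =>
  symplectic_form (@NK3_metric R) p b (delta_mx 0 j))).
  by rewrite mxE dotE; apply: eq_bigr => i _; rewrite !mxE.
by move=> *; exact: symplectic_formPl.
Qed.

Lemma bracket_frame p A B x :
  bracket x (lsubmx (frame p A B)) = bracket x A.
Proof. by rewrite -(bracket_translate (lsubmx p)) translate_frame. Qed.

(** Nondegeneracy: for b in the kernel with components (A, B), pairing with (0, A) gives |A|^2 = 0,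
    and then pairing with (B, 0) gives |B|^2 = 0. *)
Lemma symplectic_mx_unit p : symplectic_mx (@NK3_metric R) p \in unitmx.
Proof.
rewrite -row_free_unit; apply: inj_row_free => b.
rewrite mul_symplectic_mx => b0.
have {}b0 b' : symplectic_form (@NK3_metric R) p b b' = 0.
  rewrite -(dot_row_linear (l := symplectic_form (@NK3_metric R) p b)).
    by rewrite b0 dot0r.
  by move=> *; exact: symplectic_formPr.
have A0 : translate (lsubmx p) (lsubmx b) = 0.
  apply: dotxx_eq0; have := b0 (frame p 0 (translate (lsubmx p) (lsubmx b))).
  rewrite symplectic_formE translate_frame body_velocity_diff_frame.
  by rewrite bracket_frame bracket0r !dot0r subr0 addr0.
have B0 : dY p b = 0.
  apply: dotxx_eq0; have := b0 (frame p (dY p b) 0).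
  rewrite symplectic_formE translate_frame body_velocity_diff_frame.
  rewrite bracket_frame bracketC -(bracket_translate (lsubmx p)) A0 bracket0r.
  by rewrite oppr0 !dot0r addr0 sub0r => /eqP; rewrite oppr_eq0 => /eqP.
by rewrite -(frameK p b) A0 B0 frame00.
Qed.

(** * Hamiltonian vectors and Poisson brackets in the components (A, B) *)

(* That is, [frame p A B] is the Hamiltonian vector of [f] at [p]. *)
Definition hamiltonian_at (f : 'rV[R]_(n + n) -> R) p (A B : 'rV[R]_n) : Prop :=
  forall b, is_derive p b f
    (dot (dY p b) A - dot B (translate (lsubmx p) (lsubmx b)) +
     dot (Y p) (bracket A (lsubmx b))).

Lemma hamiltonian_at_gradient f p A B b : hamiltonian_at f p A B ->
  dot b (gradient f p) =
  dot (dY p b) A - dot B (translate (lsubmx p) (lsubmx b))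
    + dot (Y p) (bracket A (lsubmx b)).
Proof.
move=> hf; pose df b := dot (dY p b) A -
  dot B (translate (lsubmx p) (lsubmx b)) + dot (Y p) (bracket A (lsubmx b)).
rewrite -/(df b) -(dot_row_linear (l := df)) => [|c x y].
  congr dot; apply/rowP => i; rewrite !mxE.
  by apply: derive_val; exact: hf.
rewrite /df body_velocity_diffP !linearP /= translateP bracketDr bracketZr.
by rewrite !(dotDl, dotZl, dotDr, dotZr); ring.
Qed.

(** Since the symplectic matrix is invertible, it suffices that [frame p A B] is sent by it to the
    gradient. *)
Lemma hamiltonian_fieldE f p A B : hamiltonian_at f p A B ->
  hamiltonian_field (@NK3_metric R) f p = frame p A B.
Proof.
move=> hf; rewrite /hamiltonian_field (_ : gradient f p =
    frame p A B *m symplectic_mx (@NK3_metric R) p).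
  by rewrite mulmxK // symplectic_mx_unit.
rewrite mul_symplectic_mx; apply/rowP => i; rewrite !mxE.
rewrite symplectic_formE translate_frame body_velocity_diff_frame.
rewrite (bracketC _ (lsubmx (frame p A B))) bracket_frame -bracketC.
exact: (@derive_val _ _ _ _ _ _ _ (hf _)).
Qed.

Lemma poissonE f h p A B A' B' :
  hamiltonian_at f p A B -> hamiltonian_at h p A' B' ->
  poisson (@NK3_metric R) f h p =
  dot B' A - dot B A' + dot (Y p) (bracket A A').
Proof.
move=> hf hh; rewrite /poisson (hamiltonian_fieldE hf) (hamiltonian_fieldE hh).
rewrite symplectic_formE !translate_frame !body_velocity_diff_frame.
by rewrite bracket_frame bracketC bracket_frame -bracketC.
Qed.

(** * The six integrals and their involution *)

Lemma sum3 (F : 'I_3 -> R) : \sum_(i < 3) F i = F 0 + F 1 + F (1 + 1).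
Proof.
rewrite !big_ord_recl big_ord0 addr0 addrA.
by congr (F _ + F _ + F _); apply: val_inj.
Qed.

(** Indices are kept in the form 0, 1, 1 + 1, so that this equation reduces every cyclic shift. *)
Lemma I3_cycle : 1 + 1 + 1 = 0 :> 'I_3.
Proof. exact: val_inj. Qed.

Lemma I3_case (P : 'I_3 -> Prop) : P 0 -> P 1 -> P (1 + 1) -> forall i, P i.
Proof.
move=> P0 P1 P2; case=> -[|[|[|//]]] lti.
- by rewrite (_ : Ordinal _ = 0) //; exact: val_inj.
- by rewrite (_ : Ordinal _ = 1) //; exact: val_inj.
- by rewrite (_ : Ordinal _ = 1 + 1) //; exact: val_inj.
Qed.

Lemma dot_V i x : dot (V R i) x = x 0 (lshift 3 i).
Proof. exact: dot_delta. Qed.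

Lemma dot_Z i x : dot (Z R i) x = x 0 (rshift 3 i).
Proof. exact: dot_delta. Qed.

Lemma dot_split x y : dot x y =
  \sum_(i < 3) x 0 (lshift 3 i) * y 0 (lshift 3 i) +
  \sum_(i < 3) x 0 (rshift 3 i) * y 0 (rshift 3 i).
Proof. by rewrite dotE big_split_ord. Qed.

(** The symmetric matrix C for which <x, C x> / 2 is the Casimir sum_i v_i z_(i+1); the shift
    [i + 1 + 1] is i - 1 modulo 3. *)
Definition casimir_mx x : 'rV[R]_n :=
  row_mx (\row_i x 0 (rshift 3 (i + 1))) (\row_i x 0 (lshift 3 (i + 1 + 1))).

Lemma casimir_mx_lshift x i :
  casimir_mx x 0 (lshift 3 i) = x 0 (rshift 3 (i + 1)).
Proof. by rewrite row_mxEl mxE. Qed.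

Lemma casimir_mx_rshift x i :
  casimir_mx x 0 (rshift 3 i) = x 0 (lshift 3 (i + 1 + 1)).
Proof. by rewrite row_mxEr mxE. Qed.

Lemma dot_casimir_mxC x y : dot x (casimir_mx y) = dot y (casimir_mx x).
Proof.
rewrite !dot_split !sum3 !casimir_mx_lshift !casimir_mx_rshift.
by rewrite !I3_cycle !add0r; ring.
Qed.

(** With w_i = z_(i+1), the V-part of C x, this is the triple product w . (w x y). It is the Casimir
    property: C x acts trivially on x by the coadjoint action. *)
Lemma dot_bracket_casimir_mx x y : dot x (bracket (casimir_mx x) y) = 0.
Proof.
rewrite dot_split big1 ?add0r => [|i _]; last by rewrite bracket_lshift mulr0.
rewrite sum3 !bracket_rshift !casimir_mx_lshift.
by rewrite !I3_cycle !add0r; ring.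
Qed.

(** The vector ad_x^* x, the right-hand side of the Euler equation for the body velocity. *)
Definition coadjoint x : 'rV[R]_n := \row_i dot x (bracket x (delta_mx 0 i)).

Lemma dot_coadjoint x y : dot (coadjoint x) y = dot x (bracket x y).
Proof.
rewrite dotC /coadjoint (dot_row_linear (l := fun y => dot x (bracket x y))) //.
by move=> c u v; rewrite bracketDr bracketZr dotDr dotZr.
Qed.

(** Ad(q^-1) V_0 for q the position: the left translate of the right-invariant field of V_0. The
    exponential series of -ad q stops at first order. *)
Definition momentum_axis p : 'rV[R]_n := V R 0 - bracket (lsubmx p) (V R 0).

Lemma bracket_momentum_axis p x :
  bracket (momentum_axis p) x = bracket (V R 0) x.
Proof. by rewrite /momentum_axis bracketDl bracketNl bracket_center subr0. Qed.

(* [(integral_axis p i, integral_force p i)] are the components (A, B) of the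
   Hamiltonian vector at [p] of the [i]-th integral. *)
Definition integral_axis p (i : 'I_n) : 'rV[R]_n :=
  match fintype.split i with
  | inl j => Z R j
  | inr j => [:: casimir_mx (Y p); Y p; momentum_axis p]`_j
  end.

Definition integral_force p (i : 'I_n) : 'rV[R]_n :=
  match fintype.split i with
  | inl j => 0
  | inr j => [:: 0; coadjoint (Y p); 0]`_j
  end.

Definition K3_integral (i : 'I_n) p : R :=
  match fintype.split i with
  | inl j => dot (Y p) (Z R j)
  | inr j => [:: 2^-1 * dot (Y p) (casimir_mx (Y p));
                 2^-1 * dot (Y p) (Y p);
                 dot (Y p) (momentum_axis p)]`_j
  end.

Lemma hamiltonian_at_integral i p :
  hamiltonian_at (K3_integral i) p (integral_axis p i) (integral_force p i).
Proof.
move=> b; rewrite /integral_axis /integral_force /K3_integral.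
have dYp := is_derive_body_velocity p b.
case: (fintype.split i) => j.
  apply: is_derive_eq; first by apply: is_derive_dot; exact: is_derive_cst.
  by rewrite bracketZ_center !dot0r dot0l subr0.
elim/I3_case: j => /=.
- apply: is_derive_eq.
    apply: is_deriveZ; apply: is_derive_dot.
    apply: (is_derive_mx (dM := casimir_mx (dY p b))) => k l; rewrite ord1 {k}.
    case: (split_ordP l) => k ->.
      rewrite casimir_mx_lshift (_ : (fun r => _) =
        fun r => (Y r) 0 (rshift 3 (k + 1))); first exact: is_derive_coord.
      by apply/funext => r; rewrite casimir_mx_lshift.
    rewrite casimir_mx_rshift (_ : (fun r => _) =
      fun r => (Y r) 0 (lshift 3 (k + 1 + 1))); first exact: is_derive_coord.
    by apply/funext => r; rewrite casimir_mx_rshift.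
  (* The bracket term vanishes by the Casimir property; by symmetry of C the two halves of the
     differential agree. *)
  rewrite dot_bracket_casimir_mx dot0l subr0 addr0 (dot_casimir_mxC (Y p)).
  by rewrite /GRing.scale /=; field.
- apply: is_derive_eq; first by apply: is_deriveZ; apply: is_derive_dot.
  (* The force ad_Y^* Y cancels the bracket term exactly. *)
  rewrite dot_coadjoint bracket_translate subrK (dotC (Y p)).
  by rewrite /GRing.scale /=; field.
- apply: is_derive_eq.
    apply: is_derive_dot; apply: is_deriveB.
    by apply: is_derive_bracket; exact: is_derive_lsubmx.
  (* The base-point derivative of the axis, -[b, V_0] for b the position part, is the bracket term
     [V_0, b]. *)
  rewrite bracket_momentum_axis dot0l subr0 bracket0r addr0 sub0r.
  by rewrite -bracketC.
Qed.

Lemma poisson_integral i j p :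
  poisson (@NK3_metric R) (K3_integral i) (K3_integral j) p = 0.
Proof.
rewrite (poissonE (hamiltonian_at_integral i p) (hamiltonian_at_integral j p)).
rewrite /integral_axis /integral_force.
case: (fintype.split i) => {}i; [|elim/I3_case: i];
  (case: (fintype.split j) => {}j; [|elim/I3_case: j]);
  rewrite /= ?dot_coadjoint ?dot0l ?bracketZ_center ?bracketZ_central
    ?bracketxx ?dot_bracket_casimir_mx ?(bracketC (casimir_mx _))
    ?dotNr ?dot_bracket_casimir_mx ?dot0r ?oppr0 ?subr0 ?sub0r ?addr0 ?addNr //.
(* The remaining pair is momentum against energy, where the force of the energy cancels the bracket
   by antisymmetry. *)
by rewrite (bracketC (Y p)) dotNr addrN.
Qed.

Lemma smooth_integral i : smooth (K3_integral i).
Proof.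
rewrite /K3_integral; case: (fintype.split i) => j.
  by apply: smooth_dot => k; [exact: smooth_body_velocity | exact: smooth_cst].
elim/I3_case: j => /=.
- apply: smoothM; first exact: smooth_cst.
  apply: smooth_dot => k; first exact: smooth_body_velocity.
  case: (split_ordP k) => l ->.
    rewrite (_ : (fun p => _) = fun p => Y p 0 (rshift 3 (l + 1))).
      exact: smooth_body_velocity.
    by apply/funext => p; rewrite casimir_mx_lshift.
  rewrite (_ : (fun p => _) = fun p => Y p 0 (lshift 3 (l + 1 + 1))).
    exact: smooth_body_velocity.
  by apply/funext => p; rewrite casimir_mx_rshift.
- apply: smoothM; first exact: smooth_cst.
  by apply: smooth_dot => k; exact: smooth_body_velocity.
- apply: smooth_dot => k; first exact: smooth_body_velocity.
  rewrite (_ : (fun p => _) = fun p => V R 0 0 k +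
    (-1) * bracket (lsubmx p) (V R 0) 0 k).
    apply: smoothD; first exact: smooth_cst.
    apply: smoothM; first exact: smooth_cst.
    by apply: smooth_bracket => l; [exact: smooth_lsubmx | exact: smooth_cst].
  by apply/funext => p; rewrite /momentum_axis !mxE mulN1r.
Qed.

(** * Independence on an open dense set *)

(* Up to sign, the minor of the gradients in Y of the Casimir and of the energy
   in the directions V_0 and V_2. *)
Definition K3_minor p : R :=
  Y p 0 (rshift 3 0) * Y p 0 (lshift 3 0) -
  Y p 0 (rshift 3 1) * Y p 0 (lshift 3 (1 + 1)).

Lemma row_free_integral p : Y p 0 (rshift 3 0) != 0 -> K3_minor p != 0 ->
  row_free (\matrix_i gradient (K3_integral i) p).
Proof.
move=> z0 m0; apply: inj_row_free => a aM.
have aE b : \sum_i a 0 i * (dot (dY p b) (integral_axis p i) -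
    dot (integral_force p i) (translate (lsubmx p) (lsubmx b)) +
    dot (Y p) (bracket (integral_axis p i) (lsubmx b))) = 0.
  rewrite -[RHS](dot0r b) -aM dot_mulmx; apply: eq_bigr => i _.
  by rewrite rowK (hamiltonian_at_gradient _ (hamiltonian_at_integral i p)).
have bV01 : bracket (V R 0) (V R 1) = Z R 0 by rewrite -bracketVV add0r.
(* On (V_1, 0) every differential vanishes except that of the momentum, which is <Y, [V_0, V_1]> =
   z_0. *)
have a5 : a 0 (rshift 3 (1 + 1)) = 0.
  have := aE (frame p (V R 1) 0).
  rewrite translate_frame body_velocity_diff_frame.
  under eq_bigr do rewrite bracket_frame dot0l sub0r.
  rewrite big_split_ord !sum3 /integral_axis /integral_force.
  rewrite !(unsplitK (inl _)) !(unsplitK (inr _)) /=.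
  rewrite !bracketZ_center dot_bracket_casimir_mx dot_coadjoint !dot0l !dot0r.
  rewrite addNr bracket_momentum_axis.
  rewrite oppr0 !addNr !mulr0 !add0r bV01 dotC dot_Z.
  by move/eqP; rewrite mulf_eq0 (negPf z0) orbF => /eqP.
(* Vertical vectors (0, x) see only the axes. *)
have ax x : \sum_(i < n) a 0 i * dot x (integral_axis p i) = 0.
  have := aE (frame p 0 x).
  rewrite translate_frame body_velocity_diff_frame => ax0; rewrite -[RHS]ax0.
  by apply: eq_bigr => i _; rewrite bracket_frame bracket0r !dot0r subr0 addr0.
have {aE} aj x : \sum_(j < 3) a 0 (lshift 3 j) * dot x (Z R j) +
    (a 0 (rshift 3 0) * dot x (casimir_mx (Y p)) +
     a 0 (rshift 3 1) * dot x (Y p)) = 0.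
  have := ax x; rewrite big_split_ord [X in _ + X = _ -> _]sum3 /integral_axis.
  rewrite !(unsplitK (inr _)) /= a5 mul0r addr0 => ax0.
  rewrite -[RHS]ax0; congr (_ + _).
  by apply: eq_bigr => j _; rewrite (unsplitK (inl _)).
(* Testing on V_j removes the z_i and leaves the Casimir and the energy. *)
have avj j : a 0 (rshift 3 0) * Y p 0 (rshift 3 (j + 1)) +
    a 0 (rshift 3 1) * Y p 0 (lshift 3 j) = 0.
  have := aj (V R j); rewrite big1 ?add0r => [|k _].
    by rewrite !dot_V casimir_mx_lshift.
  by rewrite dot_V mxE eqxx /= eq_lrshift mulr0.
have a4 : a 0 (rshift 3 1) = 0.
  apply/eqP; rewrite -(mulIr_eq0 _ (mulIf m0)); apply/eqP.
  (* z_0 times the relation for j = 0 minus z_1 times that for j = 2 eliminates the Casimir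
     coefficient and leaves the minor. *)
  transitivity (Y p 0 (rshift 3 0) *
    (a 0 (rshift 3 0) * Y p 0 (rshift 3 (0 + 1)) +
     a 0 (rshift 3 1) * Y p 0 (lshift 3 0)) -
     Y p 0 (rshift 3 1) * (a 0 (rshift 3 0) * Y p 0 (rshift 3 (1 + 1 + 1)) +
     a 0 (rshift 3 1) * Y p 0 (lshift 3 (1 + 1)))).
    by rewrite I3_cycle add0r /K3_minor; ring.
  by rewrite !avj !mulr0 subrr.
have a3 : a 0 (rshift 3 0) = 0.
  have := avj (1 + 1); rewrite a4 mul0r addr0 I3_cycle => /eqP.
  by rewrite mulf_eq0 (negPf z0) orbF => /eqP.
have al j : a 0 (lshift 3 j) = 0.
  have := aj (Z R j); rewrite a3 a4 !mul0r !addr0 (bigD1 j) //= big1 => [|k kj].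
    by rewrite dot_Z mxE !eqxx mulr1 addr0.
  by rewrite dot_Z mxE eqxx /= eq_rshift eq_sym (negPf kj) mulr0.
apply/rowP => i; rewrite [RHS]mxE; case: (split_ordP i) => j -> //.
by elim/I3_case: j.
Qed.

Lemma integrals_independent_dense : exists U : set 'rV[R]_(n + n),
  [/\ open U, dense U
    & forall p, U p -> row_free (\matrix_i gradient (K3_integral i) p)].
Proof.
have cY j : continuous (fun p => Y p 0 j).
  exact/smooth_continuous/smooth_body_velocity.
have o0 : open [set p | Y p 0 (rshift 3 0) != 0].
  apply: (@open_comp _ _ (fun p => Y p 0 (rshift 3 0)) [set x | x != 0]).
    by move=> p _; exact: cY.
  exact: open_neq.
have o1 : open [set p | K3_minor p != 0].
  apply: (@open_comp _ _ K3_minor [set x | x != 0]); last exact: open_neq.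
  move=> p _; apply: (@continuousB _ _ _
    (fun p => Y p 0 (rshift 3 0) * Y p 0 (lshift 3 0))
    (fun p => Y p 0 (rshift 3 1) * Y p 0 (lshift 3 (1 + 1)))).
    by apply: continuousM; exact: cY.
  by apply: continuousM; exact: cY.
exists ([set p | Y p 0 (rshift 3 0) != 0] `&` [set p | K3_minor p != 0]).
split; first exact: openI.
  (* The order matters: z_0 is made nonzero first, since moving Y by t V_0 changes the minor by t
     z_0. For z_0 itself, Y moves by t Z_0. *)
  apply: dense_line_perturb => //.
    rewrite -[X in dense X]setTI; apply: dense_line_perturb.
    - exact: openT.
    - by move=> O O0 _; rewrite setIT.
    move=> p _; have [p0|] := eqVneq (Y p 0 (rshift 3 0)) 0; [right | by left].
    exists (row_mx 0 (untranslate (lsubmx p) (Z R 0))) => t t0 /=.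
    by rewrite body_velocity_line !mxE p0 !eqxx mulr1 add0r.
  move=> p /= p0; have [m0|] := eqVneq (K3_minor p) 0; [right | by left].
  exists (row_mx 0 (untranslate (lsubmx p) (V R 0))) => t t0 /=.
  rewrite /K3_minor body_velocity_line !mxE !eq_rlshift !eq_lshift /=.
  rewrite mulr0 mulr1 !addr0 mulrDr addrAC.
  by rewrite -/(K3_minor p) m0 add0r mulf_neq0.
by move=> p [p0 m0]; exact: row_free_integral.
Qed.

End NK3.

Theorem mainTheorem5 (R : realType) : completely_integrable (@NK3_metric R).
Proof.
exists (@K3_integral R); split=> [i|i j p|].
- split; first exact: smooth_integral.
  (* The energy is itself one of the six functions, so conservation is an instance of involution. *)
  move=> p; rewrite (_ : energy _ = K3_integral (rshift 3 1)).
    exact: poisson_integral.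
  by rewrite energyE /K3_integral (unsplitK (inr _)).
- exact: poisson_integral.
- exact: integrals_independent_dense.
Qed.
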